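(* Let $\mathbf{F}$ be a finite field with $q$ elements, $V=\mathbf{F}^n$, and $k$ a field in which $q$ is nonzero. For each subspace $W\subseteq V$ define \[ \eta_W = q^{-\dim W\cdot \dim(V/W)}\,\mu(\dim W)^{-1}\sum_{\substack{T\colon V\to V \text{ semi-idempotent}\\ \operatorname{im} T\subseteq W}} \mu(\mathrm{srk}\, T)\,[T]\in k[\mathfrak{M}_n]. \] Then the elements $\eta_W$ (as $W$ ranges over all subspaces of $V$) are pairwise orthogonal idempotents of $k[\mathfrak{M}_n]$ (i.e. $\eta_W^2=\eta_W$ and $\eta_{W_1}\eta_{W_2}=0$ for $W_1\ne W_2$). Moreover, for $0\le r\le n-1$, \[ \eta_r=\sum_{\dim W\le r}\eta_W, \] where $\eta_r = q^{-(n-1)r}\mu(r)\sum_m \mu(\mathrm{srk}\, m)\binom{n-1-\operatorname{rank} m}{r-\operatorname{rank} m}_q [m]$ (sum over semi-idempotent $m\in\mathfrak{M}_n$ of rank $\le r$). Finally, $\psi_r(\eta_W)=[\mathrm{id}_W]$ if $\dim W=r$, and $\psi_r(\eta_W)=0$ if $\dim W<r$.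
   Context: $\mathfrak{M}_n$ is the monoid of $n\times n$ matrices over $\mathbf{F}$ (identified with $\operatorname{End}_{\mathbf{F}}(V)$), $k[\mathfrak{M}_n]$ its monoid algebra with basis $[m]$. A linear operator $T$ on $V$ is semi-idempotent if $V=X\oplus Y$ with $X,Y$ $T$-stable, $T|_X=\mathrm{id}$, $T|_Y$ nilpotent. $\mathrm{srk}\,T$ is the rank of $T^i$ for $i\gg0$. $\mu(i)=(-1)^iq^{\binom i2}$; $\binom{a}{b}_q$ is the $q$-binomial coefficient. $\mathcal{G}_{n,r}$ is the groupoid whose objects are the $r$-dimensional subspaces of $\mathbf{F}^n$ and whose morphisms are linear isomorphisms; its groupoid algebra $k[\mathcal{G}_{n,r}]$ has basis $[a]$ for isomorphisms $a$, with $[b][a]=[b\circ a]$ if composable and $0$ otherwise. The linear map $\psi_r\colon k[\mathfrak{M}_n]\to k[\mathcal{G}_{n,r}]$ is $\psi_r([m])=\sum_U [m|_U]$, summing over $r$-dimensional subspaces $U$ with $\dim m(U)=r$, where $m|_U$ is regarded as an isomorphism $U\to m(U)$. *)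

(* Defs.v *)
From Stdlib Require Import ClassicalEpsilon.
From mathcomp Require Import all_boot all_order all_algebra.
Set Implicit Arguments. Unset Strict Implicit. Unset Printing Implicit Defensive.
Import GRing.Theory.
Local Open Scope ring_scope.

(* Conventions: V = F^n is the space of row vectors 'rV[F]_n; a matrix
   m : 'M[F]_n acts on V on the right, v |-> v *m m.  A subspace of V is
   represented by any matrix whose row space it is (mxalgebra); the
   canonical representative of a subspace U is <<U>>%MS.  The image of a
   subspace U under m is the row space of U *m m; im m = row space of m. *)

Section Defs.
Variables (F : finFieldType) (k : fieldType) (n : nat).

Definition q : nat := #|F|.

(* composition a o b of the linear maps a, b (right action): v |-> (v b) a *)
Definition mcomp (a b : 'M[F]_n) : 'M[F]_n := b *m a.

Notation malg := ({ffun 'M[F]_n -> k^o}).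
Definition mbase (m : 'M[F]_n) : malg := [ffun x => (x == m)%:R].
Definition amul (f g : malg) : malg :=
  [ffun m => \sum_(a : 'M[F]_n) \sum_(b : 'M[F]_n | mcomp a b == m) f a * g b].

Definition semi_idemP (T : 'M[F]_n) : Prop :=
  exists X Y : 'M[F]_n,
    (X + Y == 1%:M)%MS /\ (X :&: Y == (0 : 'M[F]_n))%MS /\
    (X *m T <= X)%MS /\ (Y *m T <= Y)%MS /\
    (forall x : 'rV[F]_n, (x <= X)%MS -> x *m T = x) /\
    (exists e : nat, forall y : 'rV[F]_n, (y <= Y)%MS -> y *m T ^+ e = 0).
Definition semi_idem (T : 'M[F]_n) : bool :=
  if excluded_middle_informative (semi_idemP T) then true else false.

Definition srk (T : 'M[F]_n) : nat :=
  epsilon (inhabits 0%N)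
    (fun r => exists N, forall i, (N <= i)%N -> \rank (T ^+ i) = r).

Definition mu (i : nat) : k := (-1) ^+ i * (q%:R) ^+ 'C(i, 2).

Fixpoint qbin (a b : nat) {struct a} : nat :=
  match a, b with
  | _, 0 => 1
  | 0, _.+1 => 0
  | a'.+1, b'.+1 => qbin a' b' + q ^ b'.+1 * qbin a' b'.+1
  end.

Definition eta (W : 'M[F]_n) : malg :=
  ((q%:R) ^- (\rank W * (n - \rank W)) * (mu (\rank W))^-1) *:
    \sum_(T : 'M[F]_n | semi_idem T && (T <= W)%MS) mu (srk T) *: mbase T.

Definition eta_r (r : nat) : malg :=
  ((q%:R) ^- ((n - 1) * r) * mu r) *:
    \sum_(m : 'M[F]_n | semi_idem m && (\rank m <= r)%N)
       (mu (srk m) * (qbin (n - 1 - \rank m) (r - \rank m))%:R) *: mbase m.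

(* The groupoid algebra k[G_{n,r}] (as a vector space).  A morphism
   U -> U' (linear isomorphism) is encoded as the pair (U, Phi) where U is
   the canonical matrix <<U>> and Phi = U *m m for any linear m extending
   the isomorphism (the map is determined since the rows of U span U);
   its codomain is the row space of Phi. *)
Definition is_gmor (r : nat) (p : 'M[F]_n * 'M[F]_n) : bool :=
  [&& <<p.1>>%MS == p.1, \rank p.1 == r, \rank p.2 == r &
      [exists m : 'M[F]_n, p.1 *m m == p.2]].
Notation galg := ({ffun ('M[F]_n * 'M[F]_n) -> k^o}).
Definition gbase (a : 'M[F]_n * 'M[F]_n) : galg := [ffun p => (p == a)%:R].
Definition gres (U m : 'M[F]_n) : 'M[F]_n * 'M[F]_n := (U, U *m m).

Definition psi (r : nat) (x : malg) : galg :=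
  \sum_(m : 'M[F]_n) x m *:
     \sum_(U : 'M[F]_n | [&& <<U>>%MS == U, \rank U == r & \rank (U *m m) == r])
        gbase (gres U m).

End Defs.

Arguments mcomp {F n} a b.
Arguments mbase {F} k {n} m.
Arguments amul {F k n} f g.
Arguments semi_idem {F n} T.
Arguments srk {F n} T.
Arguments mu F {k} i.
Arguments eta {F} k {n} W.
Arguments eta_r F k n r.
Arguments gbase {F} k {n} a.
Arguments gres {F n} U m.
Arguments psi {F k n} r x.

(* Main.v *)
(* Write phi(T) = mu (srk T) if T is semi-idempotent and 0 otherwise.  Since
   T is semi-idempotent iff its powers stabilise, phi (A B) = phi (B A) even for
   rectangular A and B.  The heart of the matter is that the sum of phi over
   all endomorphisms of W with a prescribed restriction to a proper subspace
   vanishes; dually, so does the sum over those with a prescribed composite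
   with a non-injective map out of W.  This is proved for a hyperplane by
   induction on dim W.  As phi (T) only depends on T|_W when im T lies in W,
   the sum defining eta_W kills every product that only sees T on a subspace
   not containing W, and every product with a map that is not injective on W;
   what survives is T|_W = id, with q^(w (n - w)) such T.  The formula for eta_r
   is then a comparison of coefficients, by counting the w-dimensional
   subspaces containing im T. *)
From Stdlib Require Import ClassicalEpsilon.
Require Import Defs.
From mathcomp Require Import all_boot all_order all_algebra zify ring.
Set Implicit Arguments. Unset Strict Implicit. Unset Printing Implicit Defensive.
Import GRing.Theory.
Local Open Scope ring_scope.

(** * Eventually constant powers, semi-idempotents and stable rank *)

Section StablePowers.
Variable F : finFieldType.

Lemma expmx_swap p r (A : 'M[F]_(p, r)) (B : 'M_(r, p)) N :
  (A *m B) ^+ N.+1 = A *m (B *m A) ^+ N *m B.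
Proof.
elim: N => [|N IH]; first by rewrite expr1 expr0 mulmx1.
rewrite exprS IH -!mulmxE [(B *m A) ^+ N.+1]exprS -mulmxE.
by rewrite !mulmxA.
Qed.

Lemma trmx_exp n (T : 'M[F]_n) N : (T ^+ N)^T = T^T ^+ N.
Proof.
elim: N => [|N IH]; first by rewrite !expr0 trmx1.
by rewrite exprS exprSr -!mulmxE trmx_mul IH.
Qed.

Lemma expr_stable n (T : 'M[F]_n) N i :
  T ^+ N.+1 = T ^+ N -> (N <= i)%N -> T ^+ i = T ^+ N.
Proof.
move=> TN /subnK <-; elim: (i - N)%N => [|j IH] //.
by rewrite addSn exprS IH -exprS.
Qed.

(** Fitting decomposition: if the powers stabilise at T^N, then T^N is a projection, whose image and
    kernel serve as X and Y. Conversely, an exponent killing Y works, since T fixes X pointwise. *)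
Lemma semi_idemP_stable n (T : 'M[F]_n) :
  semi_idemP T <-> exists N, T ^+ N.+1 = T ^+ N.
Proof.
split=> [[X [Y [XY1 [_ [_ [_ [XT [e YT]]]]]]]]|[N TN]].
  exists e; apply/row_matrixP=> i; rewrite !rowE.
  have : ((delta_mx 0 i : 'rV_n) <= X + Y)%MS.
    by case/andP: XY1 => _; apply: submx_trans; apply: submx1.
  case/sub_addsmxP=> -[u v] /= ->.
  have XTe j : u *m X *m T ^+ j = u *m X.
    elim: j => [|j IH]; first by rewrite expr0 mulmx1.
    by rewrite exprS -mulmxE mulmxA XT ?IH ?submxMl.
  by rewrite !mulmxDl !XTe exprSr -mulmxE mulmxA YT ?submxMl // mul0mx.
have TT : T ^+ N *m T = T ^+ N by rewrite mulmxE -exprSr.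
have TNN : T ^+ N *m T ^+ N = T ^+ N.
  by rewrite mulmxE -exprD (expr_stable TN) // leq_addr.
exists (T ^+ N), (kermx (T ^+ N)); split; [|split; [|split; [|split; [|split]]]].
- apply/andP; split; first exact: submx1.
  have -> : 1%:M = T ^+ N + (1%:M - T ^+ N) by rewrite addrC subrK.
  apply: addmx_sub_adds => //; apply/sub_kermxP.
  by rewrite mulmxBl mul1mx TNN subrr.
- apply/andP; split; last exact: sub0mx.
  apply/rV_subP=> v; rewrite sub_capmx => /andP[].
  by case/submxP=> u -> /sub_kermxP; rewrite -mulmxA TNN => ->; rewrite sub0mx.
- by rewrite TT.
- apply/sub_kermxP; rewrite -mulmxA mulmxE -(exprS T) TN.
  by apply/sub_kermxP.
- by move=> x /submxP[u ->]; rewrite -mulmxA TT.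
- by exists N => y /sub_kermxP.
Qed.

Lemma semi_idem_stableP n (T : 'M[F]_n) :
  reflect (exists N, T ^+ N.+1 = T ^+ N) (semi_idem T).
Proof.
rewrite /semi_idem; case: excluded_middle_informative => h; constructor.
  exact/semi_idemP_stable.
by move/semi_idemP_stable.
Qed.

(** Two eventual values of the rank agree beyond both thresholds, so the value picked by [epsilon]
    is the expected one. *)
Lemma srkE n (T : 'M[F]_n) r N :
  (forall i, (N <= i)%N -> \rank (T ^+ i) = r) -> srk T = r.
Proof.
move=> Tr.
have [M TM] := epsilon_spec (inhabits 0%N)
  (fun r => exists N, forall i, (N <= i)%N -> \rank (T ^+ i) = r)
  (ex_intro _ r (ex_intro _ N Tr)).
by rewrite -(Tr (maxn N M)) ?leq_maxl // (TM (maxn N M)) ?leq_maxr.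
Qed.

Lemma srk_stable n (T : 'M[F]_n) N :
  T ^+ N.+1 = T ^+ N -> srk T = \rank (T ^+ N).
Proof. by move=> TN; apply: (@srkE _ _ _ N) => i /(expr_stable TN) ->. Qed.

Lemma stable_swap p r (A : 'M[F]_(p, r)) (B : 'M_(r, p)) N :
  (B *m A) ^+ N.+1 = (B *m A) ^+ N -> (A *m B) ^+ N.+2 = (A *m B) ^+ N.+1.
Proof. by move=> BA; rewrite expmx_swap BA -expmx_swap. Qed.

Lemma semi_idem_swap p r (A : 'M[F]_(p, r)) (B : 'M_(r, p)) :
  semi_idem (A *m B) = semi_idem (B *m A).
Proof.
by apply/semi_idem_stableP/semi_idem_stableP=> -[N] /stable_swap; exists N.+1.
Qed.

Lemma srk_swap p r (A : 'M[F]_(p, r)) (B : 'M_(r, p)) :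
  semi_idem (A *m B) -> srk (A *m B) = srk (B *m A).
Proof.
case/semi_idem_stableP=> N AB; have BA := stable_swap AB.
have rk_le s t (C : 'M[F]_(s, t)) (D : 'M_(t, s)) j :
  (\rank ((C *m D) ^+ j.+1) <= \rank ((D *m C) ^+ j))%N.
  by rewrite expmx_swap (leq_trans (mxrankM_maxl _ _)) ?mxrankM_maxr.
rewrite (srk_stable AB) (srk_stable BA); apply/eqP; rewrite eqn_leq rk_le andbT.
(* Stability lets N be raised to N + 2, so that [rk_le] lands on the exponent N + 1 of B A. *)
have -> : (A *m B) ^+ N = (A *m B) ^+ N.+2 by rewrite (expr_stable AB) // !leqW.
exact: rk_le.
Qed.

Lemma semi_idem_tr n (T : 'M[F]_n) : semi_idem T^T = semi_idem T.
Proof.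
apply/semi_idem_stableP/semi_idem_stableP=> -[N TN]; exists N.
  by apply: trmx_inj; rewrite !trmx_exp.
by rewrite -!trmx_exp TN.
Qed.

Lemma srk_tr n (T : 'M[F]_n) : semi_idem T -> srk T^T = srk T.
Proof.
case/semi_idem_stableP=> N TN.
by rewrite (srk_stable TN) (@srk_stable _ _ N) -!trmx_exp ?TN ?mxrank_tr.
Qed.

(** An invertible T can be cancelled from T^(N+1) = T^N until T = 1 remains. *)
Lemma semi_idem_unit n (T : 'M[F]_n) :
  T \in unitmx -> semi_idem T = (T == 1%:M).
Proof.
move=> Tu; apply/semi_idem_stableP/eqP=> [[N TN]|->]; last first.
  by exists 0%N; rewrite expr0 expr1.
elim: N TN => [|N IH]; first by rewrite expr0 expr1.
rewrite (exprS T N.+1) [in RHS](exprS T N) -!mulmxE => TN; apply: IH.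
by rewrite -[LHS](mulKmx Tu) TN mulKmx.
Qed.

Lemma srk1 n : srk (1%:M : 'M[F]_n) = n.
Proof. by rewrite (@srk_stable _ _ 0) ?expr0 ?expr1 ?mxrank1. Qed.

End StablePowers.

(** * q-binomial coefficients and the number of subspaces above a given one *)

Section Counting.
Variable F : finFieldType.

Lemma qbin0 a : qbin F a 0 = 1%N. Proof. by case: a. Qed.

Lemma qbin_small a b : (a < b)%N -> qbin F a b = 0%N.
Proof.
elim: a b => [|a IH] [|b] // ab.
by rewrite -[LHS]/(qbin F a b + #|F| ^ b.+1 * qbin F a b.+1)%N !IH ?muln0 // ltnW.
Qed.

Lemma qbinS a b : qbin F a.+1 b.+1 = (qbin F a b + #|F| ^ b.+1 * qbin F a b.+1)%N.
Proof. by []. Qed.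

(** The other q-Pascal rule, by expanding both sides with the defining one. Where [a - b] is
    truncated, it only multiplies a vanishing coefficient. *)
Lemma qbinS_dual a b :
  qbin F a.+1 b.+1 = (#|F| ^ (a - b) * qbin F a b + qbin F a b.+1)%N.
Proof.
elim: a b => [|a IH] b; first by case: b => [|b] //=; rewrite muln0.
rewrite qbinS; case: b => [|b].
  rewrite {1}IH [in RHS]qbinS !qbin0 !subn0 !expnS expn0; ring.
rewrite {1}IH {1}IH [qbin F a.+1 b.+1 in RHS]qbinS [qbin F a.+1 b.+2 in RHS]qbinS subSS.
have [ba|ab] := ltnP b a.
  rewrite subnS; move: ba; rewrite -subn_gt0; case: (a - b)%N => // e _.
  rewrite !expnS /=; ring.
by rewrite (qbin_small (leqW ab : a < b.+2)%N) (qbin_small (ab : a < b.+1)%N) !muln0 !addn0.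
Qed.

(** Subtraction-free form of (q^(b+1) - 1) [a+1, b+1] = (q^(a+1) - 1) [a, b], the recursion met when
    counting subspaces. *)
Lemma qbin_mul_diag a b :
  (#|F| ^ b.+1 * qbin F a.+1 b.+1 + qbin F a b =
   #|F| ^ a.+1 * qbin F a b + qbin F a.+1 b.+1)%N.
Proof.
have [ab|ba] := ltnP a b.
  by rewrite !(qbin_small ab) qbin_small ?ltnS // !muln0.
rewrite {1}qbinS_dual qbinS mulnDr mulnA -expnD -addnA [(_ + qbin F a b)%N]addnC.
by congr (_ ^ _ * _ + _)%N; rewrite addSn subnKC.
Qed.

Lemma card_rowspace n m (W : 'M[F]_(m, n)) :
  #|[pred v : 'rV_n | (v <= W)%MS]| = (#|F| ^ \rank W)%N.
Proof.
rewrite -[X in (#|F| ^ X)%N]mul1n -card_mx -!sum1_card.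
rewrite (reindex_onto (fun v => v *m row_base W) (fun v => v *m pinvmx (row_base W))) /=.
  apply: eq_bigl => v.
  by rewrite !inE -mulmxA mulmxVp ?row_base_free // mulmx1 eqxx -(eq_row_base W) submxMl.
by move=> v vW; rewrite mulmxKpV // eq_row_base.
Qed.

Lemma card_rowspaceD n m p (A : 'M[F]_(m, n)) (W : 'M[F]_(p, n)) :
  (A <= W)%MS ->
  (#|[pred v : 'rV_n | (v <= W)%MS && ~~ (v <= A)%MS]| + #|F| ^ \rank A =
   #|F| ^ \rank W)%N.
Proof.
move=> AW; rewrite -!card_rowspace -!sum1_card addnC.
rewrite [RHS](bigID (fun v : 'rV_n => (v <= A)%MS)) /=; congr (_ + _)%N.
apply: eq_bigl => v; rewrite !inE andbC.
by case: (boolP (v <= A)%MS) => // /submx_trans->.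
Qed.

Definition overspaces n (A : 'M[F]_n) w : pred 'M[F]_n :=
  [pred W | [&& <<W>>%MS == W, (A <= W)%MS & \rank W == w]].

Lemma rank_adds_row n (A : 'M[F]_n) (v : 'rV_n) :
  ~~ (v <= A)%MS -> \rank (A + v)%MS = (\rank A).+1.
Proof.
move=> vA; apply/eqP; rewrite eqn_leq; apply/andP; split.
  apply: leq_trans (mxrank_adds_leqif _ _) _.
  by apply: leq_trans (leq_add (leqnn _) (rank_leq_row v)) _; rewrite addn1.
have : (A < A + v)%MS by rewrite ltmxE addsmxSl addsmx_sub negb_and vA orbT.
by rewrite ltmxErank => /andP[].
Qed.

(** Induction on d = w - rank A: adjoining a vector to A lowers d by one, and a double count yields
    the recursion of [qbin_mul_diag]. *)
Lemma card_overspaces n (A : 'M[F]_n) w : (\rank A <= w)%N ->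
  #|overspaces A w| = qbin F (n - \rank A) (w - \rank A).
Proof.
move=> /subnKC <-; rewrite addKn; move: (w - _)%N => d {w}.
elim: d A => [|d IH] A.
  rewrite qbin0 addn0 -(card1 <<A>>%MS); apply: eq_card => W; rewrite !inE.
  apply/and3P/eqP => [[/eqP W1 AW /eqP WA]|->]; last first.
    by rewrite genmx_id mxrank_gen genmxE submx_refl.
  by rewrite -W1; apply/esym/eq_genmx/eqmxP; rewrite -(mxrank_leqif_eq AW) WA.
set t := \rank A; have q1 : (1 < #|F|)%N := card_finNzRing_gt1 F.
have t_le : (t <= n)%N := rank_leq_col A.
(* N counts the pairs (v, W) with A <= W, v in W outside A, \rank W = t + d + 1. *)
pose N := \sum_(v : 'rV[F]_n | ~~ (v <= A)%MS) #|overspaces (A + v)%MS (t + d.+1)|.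
(* Choosing W first: each W has q^(t+d+1) - q^t vectors outside A. *)
have N1 : (N + #|F| ^ t * #|overspaces A (t + d.+1)| =
    #|F| ^ (t + d.+1) * #|overspaces A (t + d.+1)|)%N.
  have -> : N = (\sum_(W in overspaces A (t + d.+1))
      #|[pred v : 'rV_n | (v <= W)%MS && ~~ (v <= A)%MS]|)%N.
    rewrite /N (eq_bigr (fun v => \sum_(W in overspaces (A + v)%MS (t + d.+1)) 1)%N).
      rewrite [RHS](eq_bigr (fun W => \sum_(v : 'rV_n | (v <= W)%MS && ~~ (v <= A)%MS) 1)%N).
        rewrite (exchange_big_dep (mem (overspaces A (t + d.+1)))) /=.
          apply: eq_bigr => W; rewrite inE => /and3P[W1 W2 W3]; apply: eq_bigl => v.
          by rewrite !inE W1 W3 addsmx_sub W2 andbT andbC.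
        move=> v W _; rewrite !inE addsmx_sub => /and3P[-> /andP[-> _] ->] //.
      by move=> W _; rewrite sum1_card.
    by move=> v _; rewrite sum1_card.
  rewrite mulnC -sum_nat_const -big_split /= mulnC -sum_nat_const.
  apply: eq_bigr => W; rewrite inE => /and3P[_ AW /eqP <-].
  by rewrite card_rowspaceD.
(* Choosing v first: A + v has rank t + 1, so the induction hypothesis counts the W. *)
have N2 : (N + #|F| ^ t * qbin F (n - t).-1 d = #|F| ^ n * qbin F (n - t).-1 d)%N.
  have -> : N = (#|[pred v : 'rV_n | (v <= (1%:M : 'M[F]_n))%MS && ~~ (v <= A)%MS]|
                  * qbin F (n - t).-1 d)%N.
    rewrite -sum_nat_const; apply: eq_big => v; first by rewrite inE submx1.
    by move=> vA; have := IH (A + v)%MS; rewrite rank_adds_row // subnS addSnnS.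
  by rewrite -mulnDl card_rowspaceD ?submx1 // mxrank1.
(* If A is the whole space, [(n - t).-1] is truncated and must be treated apart: N = 0 and no W
   exists. *)
have [tn|nt] := ltnP t n; last first.
  have tE : t = n by apply/eqP; rewrite eqn_leq t_le.
  move: N1; have -> : N = 0%N.
    by apply/eqP; rewrite -(eqn_add2r (#|F| ^ t * qbin F (n - t).-1 d)) N2 tE.
  have tt : (t == t + d.+1)%N = false by rewrite -{1}[t]addn0 eqn_add2l.
  move/eqP; rewrite add0n eqn_mul2r eqn_exp2l // tt orbF => /eqP ->.
  by rewrite tE subnn.
have D : (0 < #|F| ^ (t + d.+1) - #|F| ^ t)%N.
  by rewrite subn_gt0 ltn_exp2l // -{1}[t]addn0 ltn_add2l.
apply/eqP; rewrite -(eqn_pmul2l D) !mulnBl -N1 addnK.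
have := qbin_mul_diag (n - t).-1 d; rewrite prednK ?subn_gt0 // => Q.
have {}Q : (#|F| ^ t * (#|F| ^ d.+1 * qbin F (n - t) d.+1) + #|F| ^ t * qbin F (n - t).-1 d =
    N + #|F| ^ t * qbin F (n - t).-1 d + #|F| ^ t * qbin F (n - t) d.+1)%N.
  by rewrite N2 -mulnDr Q mulnDr mulnA -expnD subnKC.
move/eqP: Q; rewrite addnAC eqn_add2r mulnA -expnD => /eqP ->.
by rewrite addnK.
Qed.

End Counting.

(** Averaging: each translation by [f y] permutes X, so #|Y| times the sum is a double sum that
    vanishes on summing over y first. *)
Lemma sum_shift_eq0 (k : fieldType) (E : lmodType k) (X Y : finZmodType)
    (f : Y -> X) (G : X -> E) :
  (#|Y|%:R : k) != 0 -> (forall x, \sum_y G (x + f y) = 0) -> \sum_x G x = 0.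
Proof.
move=> Y0 sumG; apply: (scalerI Y0); rewrite scaler0 scaler_nat.
rewrite -sumr_const.
rewrite (eq_bigr (fun y => \sum_x G (x + f y))) => [|y _]; last first.
  exact: (reindex_inj (addIr (f y))).
by rewrite exchange_big /= big1.
Qed.

(** * The function phi and its invariance properties *)

Section Weight.
Variables (F : finFieldType) (k : fieldType).
Hypothesis hq : (#|F|%:R : k) != 0.

Definition weight n (T : 'M[F]_n) : k := if semi_idem T then mu F (srk T) else 0.

Lemma muS i : mu F i.+1 = - #|F|%:R ^+ i * mu F i :> k.
Proof. by rewrite /mu binS bin1 exprD exprS mulN1r !mulNr mulrA mulrC. Qed.

Lemma mu_neq0 i : mu F i != 0 :> k.
Proof. by rewrite mulf_neq0 ?signr_eq0 ?expf_neq0 // oppr_eq0 oner_eq0. Qed.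

Lemma card_mx_neq0 m n : #|{: 'M[F]_(m, n)}|%:R != 0 :> k.
Proof. by rewrite card_mx natrX expf_neq0. Qed.

Lemma weight_swap p r (A : 'M[F]_(p, r)) (B : 'M_(r, p)) :
  weight (A *m B) = weight (B *m A).
Proof.
by rewrite /weight (semi_idem_swap B); case: ifP => // /srk_swap ->.
Qed.

Lemma weight_tr n (T : 'M[F]_n) : weight T^T = weight T.
Proof. by rewrite /weight semi_idem_tr; case: ifP => // /srk_tr ->. Qed.

Lemma weight_unit n (T : 'M[F]_n) :
  T \in unitmx -> weight T = if T == 1%:M then mu F n else 0.
Proof.
by move=> Tu; rewrite /weight semi_idem_unit //; case: eqP => // ->; rewrite srk1.
Qed.

(** * Vanishing of the sums of phi over rank-one perturbations *)

Lemma sum_weight_row_step m (c : 'cV[F]_(1 + m)) (M : 'M_(1 + m)) :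
  (forall a : 'M_(m, 1 + m), \sum_(x : 'rV_(1 + m)) weight (col_mx x a) = 0) ->
  c != 0 -> \sum_(y : 'rV_(1 + m)) weight (M + c *m y) = 0.
Proof.
move=> IH c0; pose L := col_ebase c; pose u := row_ebase c.
have Lu : L \in unitmx := col_ebase_unit c.
have uu : u \in unitmx := row_ebase_unit c.
have rc : \rank c = 1%N.
  by apply/eqP; rewrite eqn_leq rank_leq_col lt0n mxrank_eq0.
(* Gaussian elimination moves c to a multiple of the first basis vector; after conjugation by [L]
   only the top row varies, and it runs over all rows. *)
have cE : c = L *m col_mx u 0.
  have pE : (pid_mx 1 : 'M[F]_(1 + m, 1)) = col_mx 1%:M 0.
    by rewrite pid_mx_col.
  by rewrite -{1}(mulmx_ebase c) rc pE -mulmxA mul_col_mx mul1mx mul0mx.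
pose N := invmx L *m M *m L.
transitivity (\sum_(y : 'rV_(1 + m)) weight (col_mx (usubmx N + u *m y *m L) (dsubmx N))).
  apply: eq_bigr => y _.
  rewrite -[M + _](mulKVmx Lu) weight_swap; congr weight.
  rewrite mulmxDr mulmxDl -/N cE mulmxA (mulKmx Lu) mul_col_mx mul0mx mul_col_mx.
  by rewrite mul0mx -{1}[N]vsubmxK add_col_mx addr0.
rewrite -[RHS](IH (dsubmx N)) [RHS](reindex_inj (addrI (usubmx N))) /=.
rewrite [RHS](reindex_inj (can_inj (mulmxK Lu))) /=.
by rewrite [RHS](reindex_inj (can_inj (mulKmx uu))).
Qed.

(* If a = E C with C of smaller height, trading (x; E C) for a product with C on
   the left lowers the dimension.  If a has full rank, either x lies in its row
   space, so that (x; a) = (y; 1) a may be traded for a (y; 1) = a1 y + a2, or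
   (x; a) is invertible and only the identity counts. *)
Lemma sum_weight_col_mx m (a : 'M[F]_(m, 1 + m)) :
  \sum_(x : 'rV_(1 + m)) weight (col_mx x a) = 0.
Proof.
elim/ltn_ind: m a => m IH a.
have [am|am] := ltnP (\rank a) m.
  (* With C = [row_base a], (x; a) = D (x; C) is traded for (x; C) D. Since L D = 1, shifting x by y
     L shifts x D by an arbitrary y. *)
  pose D : 'M_(1 + m, 1 + \rank a) := block_mx 1%:M 0 0 (col_base a).
  pose L : 'M_(1 + \rank a, 1 + m) := block_mx 1%:M 0 0 (pinvmx (col_base a)).
  have LD : L *m D = 1%:M.
    rewrite mulmx_block !mulmx0 !mul0mx !mul1mx !addr0 !add0r mulVpmx ?col_base_full //.
    by rewrite -scalar_mx_block.
  pose g (x : 'rV_(1 + \rank a)) := weight (col_mx x (row_base a *m D)).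
  rewrite (eq_bigr (fun x => g (x *m D))) => [|x _]; last first.
    rewrite /g -mul_col_mx -weight_swap mul_block_col !mul0mx mul1mx addr0 add0r.
    by rewrite mulmx_base.
  apply: (@sum_shift_eq0 k k^o 'rV[F]_(1 + m) 'rV[F]_(1 + \rank a)
            (fun y => y *m L) (fun x => g (x *m D))); first exact: card_mx_neq0.
  move=> x; rewrite -[RHS](IH _ am (row_base a *m D)).
  rewrite [RHS](reindex_inj (addrI (x *m D))) /=.
  by apply: eq_bigr => y _; rewrite mulmxDl -mulmxA LD mulmx1.
have afree : row_free a by rewrite /row_free eqn_leq rank_leq_row.
pose a1 : 'cV_m := lsubmx a; pose a2 : 'M_m := rsubmx a.
have aE : a = row_mx a1 a2 by rewrite hsubmxK.
rewrite (bigID (fun x : 'rV_(1 + m) => (x <= a)%MS)) /=.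
rewrite (reindex_onto (fun y : 'rV_m => y *m a) (fun x => x *m pinvmx a)) /=; last first.
  by move=> x; apply: mulmxKpV.
rewrite (eq_big predT (fun y => weight (a2 + a1 *m y))) /=; first last.
- move=> y _; rewrite -{2}[a]mul1mx -mul_col_mx weight_swap; congr weight.
  by rewrite aE mul_row_col mulmx1 addrC.
- by move=> y; rewrite submxMl -mulmxA mulmxVp // mulmx1 eqxx.
rewrite [X in _ + X](eq_bigr (fun x =>
    if col_mx x a == 1%:M then mu F (1 + m) else 0)) => [|x xa]; last first.
  apply: weight_unit; rewrite -row_free_unit /row_free eqn_leq rank_leq_row /=.
  have : (a < x + a)%MS by rewrite ltmxE addsmxSr addsmx_sub negb_and xa.
  by rewrite ltmxErank => /andP[_]; rewrite (eqP afree) addsmxE.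
have a1E : (lsubmx (dsubmx (1%:M : 'M[F]_(1 + m)))) = 0.
  by rewrite scalar_mx_block /block_mx col_mxKd row_mxKl.
(* If [a1] is nonzero, (x; a) is never the identity, and what remains is a rank-one perturbation sum
   in dimension m. *)
have [a10|a10] := eqVneq a1 0; last first.
  rewrite [X in _ + X]big1 ?addr0 => [|x _]; last first.
    case: ifP => // /eqP xa; case/eqP: a10; rewrite -a1E -xa /a1.
    by rewrite (col_mxKd x a).
  case: m IH a a1 a2 a1E a10 {am afree aE} => [|m] IH a a1 a2 _ a10.
    by case/eqP: a10; apply/matrixP=> -[].
  by apply: (@sum_weight_row_step m) => // b; apply: IH.
(* Now a = (0, a2) with [a2] invertible. The first sum is q^m times the weight of [a2]; if a2 = 1 it
   cancels the identity term, as mu (m + 1) = - q^m mu m. *)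
have a2u : a2 \in unitmx.
  have := afree; rewrite /row_free aE a10 => /eqP; rewrite rank_row_0mx => a2m.
  by rewrite -row_free_unit /row_free a2m.
rewrite (eq_bigr (fun=> weight a2)) => [|y _]; last by rewrite a10 mul0mx addr0.
rewrite sumr_const weight_unit //; case: (a2 =P 1%:M) => [a21|a21]; last first.
  rewrite mul0rn add0r big1 // => x _; case: ifP => // /eqP xa; case: a21.
  by rewrite /a2 -(col_mxKd x a) xa scalar_mx_block col_mxKd row_mxKr.
rewrite a10 a21 in aE; have colE (x : 'rV_(1 + m)) :
    (col_mx x a == 1%:M) = (x == row_mx 1%:M 0).
  rewrite scalar_mx_block /block_mx aE.
  apply/eqP/eqP => [/eq_col_mx[]//|->//].
rewrite (bigD1 (row_mx 1%:M 0)) /=; last first.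
  rewrite aE; apply/submxP => -[y]; rewrite mul_mx_row mulmx0 => /eq_row_mx[/eqP].
  by rewrite oner_eq0.
rewrite colE eqxx big1 => [|x /andP[_ /negPf]]; last by rewrite colE => ->.
by rewrite addr0 muS mulNr -(mulr_natl (mu F m)) card_mx mul1n natrX subrr.
Qed.

Lemma sum_weight_row m (c : 'cV[F]_m) (M : 'M_m) :
  c != 0 -> \sum_(y : 'rV_m) weight (M + c *m y) = 0.
Proof.
case: m c M => [|m] c M c0; first by case/eqP: c0; apply/matrixP=> -[].
by apply: (@sum_weight_row_step m) => // a; apply: sum_weight_col_mx.
Qed.

Lemma sum_weight_col m (r : 'rV[F]_m) (M : 'M_m) :
  r != 0 -> \sum_(y : 'cV_m) weight (M + y *m r) = 0.
Proof.
move=> r0; rewrite -[RHS](@sum_weight_row m r^T M^T) ?trmx_eq0 //.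
rewrite (reindex (@trmx F 1 m)) /=; last first.
  by apply: onW_bij; exists trmx; apply: trmxK.
apply: eq_bigr => y _.
by rewrite -weight_tr linearD /= trmx_mul trmxK.
Qed.

(** * Weighted sums over the endomorphisms with image in W *)

Lemma sum_weight_sub n (W : 'M[F]_n) (E : lmodType k) (G : 'M[F]_n -> E) :
  \sum_(T : 'M_n | (T <= W)%MS) weight T *: G T =
  \sum_(T : 'M_(n, \rank W)) weight (row_base W *m T) *: G (T *m row_base W).
Proof.
(* Factor T through a basis R of W as T' R; then [weight_swap] gives R T', the matrix of T on W. *)
rewrite (reindex_onto (fun T => T *m row_base W) (fun T => T *m pinvmx (row_base W))) /=.
  apply: eq_big => [T|T _]; last by rewrite weight_swap.
  by rewrite -mulmxA mulmxVp ?row_base_free // mulmx1 eqxx -(eq_row_base W) submxMl.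
by move=> T TW; rewrite mulmxKpV // eq_row_base.
Qed.

(** A linear form c vanishing on U but not on W exists. Adding c y to T keeps U T fixed while R T
    moves by (R c) y, so [sum_weight_row] applies. *)
Lemma sum_weight_mull_eq0 n p (W : 'M[F]_n) (U : 'M_(p, n)) (E : lmodType k)
    (g : 'M[F]_(p, n) -> E) :
  ~~ (W <= U)%MS -> \sum_(T : 'M_n | (T <= W)%MS) weight T *: g (U *m T) = 0.
Proof.
rewrite -(eq_row_base W) submxE => WU; set R := row_base W in WU *.
have [j Rj] : exists j, R *m (cokermx U *m delta_mx j 0) != 0 :> 'cV_(\rank W).
  apply/existsP; apply: contraR WU; rewrite negb_exists => /forallP R0.
  apply/eqP/trmx_inj/row_matrixP=> j.
  rewrite -tr_col colE -mulmxA; have := R0 j; rewrite negbK => /eqP ->.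
  by rewrite !trmx0 row0.
pose c : 'cV_n := cokermx U *m delta_mx j 0.
have Uc : U *m c = 0 by rewrite mulmxA mulmx_coker mul0mx.
rewrite sum_weight_sub -/R.
apply: (@sum_shift_eq0 k E _ 'rV[F]_(\rank W) (fun y => c *m y)).
  exact: card_mx_neq0.
move=> T; rewrite -[RHS](scale0r (g (U *m (T *m R)))) -(sum_weight_row (R *m T) Rj).
rewrite scaler_suml; apply: eq_bigr => y _.
by rewrite mulmxDr mulmxA mulmxDl mulmxDr -(mulmxA c) (mulmxA U c) Uc mul0mx addr0.
Qed.

(** Dually, pick r nonzero with r R S = 0 and let T vary by P y r, where R P = 1: the product with S
    is unchanged and R T moves by y r. *)
Lemma sum_weight_mulr_eq0 n p (W : 'M[F]_n) (S : 'M_(n, p)) (E : lmodType k)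
    (g : 'M[F]_(n, p) -> E) :
  (\rank (W *m S) < \rank W)%N ->
  \sum_(T : 'M_n | (T <= W)%MS) weight T *: g (T *m S) = 0.
Proof.
rewrite -(eqmxMr S (eq_row_base W)) sum_weight_sub.
have := mulmxVp (row_base_free W).
move: (pinvmx _) => P; move: (row_base W) => R RP RS.
pose r := nz_row (kermx (R *m S)).
have r0 : r != 0 by rewrite nz_row_eq0 kermx_eq0 /row_free neq_ltn RS.
have rRS : r *m (R *m S) = 0 by apply/sub_kermxP; apply: nz_row_sub.
apply: (@sum_shift_eq0 k E _ 'cV[F]_(\rank W) (fun y => P *m (y *m r))).
  exact: card_mx_neq0.
move=> T; rewrite -[RHS](scale0r (g (T *m R *m S))) -(sum_weight_col (R *m T) r0).
rewrite scaler_suml; apply: eq_bigr => y _.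
rewrite mulmxDr (mulmxA R P) RP mul1mx; congr (_ *: g _).
by rewrite -!mulmxA mulmxDl -!mulmxA rRS !mulmx0 addr0.
Qed.

Lemma card_fiber (X Y : finZmodType) (h : {additive X -> Y}) (s : Y -> X) y :
  cancel s h -> (#|[pred x | h x == y]| * #|Y| = #|X|)%N.
Proof.
move=> sK; rewrite -[RHS]sum1_card (partition_big h predT) //= mulnC.
rewrite -sum_nat_const; apply: eq_bigr => z _.
rewrite -sum1_card [LHS](reindex_inj (addIr (s y - s z))) /=.
apply: eq_bigl => x; rewrite inE raddfD raddfB /= !sK -subr_eq0 -[RHS]subr_eq0.
by rewrite [y - z]addrC addrA addrK.
Qed.

(** A fibre of the surjection T -> R T; all fibres have the same size. *)
Lemma card_linv m n (R : 'M[F]_(m, n)) :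
  row_free R -> #|[pred T : 'M_(n, m) | R *m T == 1%:M]| = (#|F| ^ (m * (n - m)))%N.
Proof.
move=> Rf; have mn : (m <= n)%N by rewrite -(eqP Rf) rank_leq_col.
have RK : cancel (mulmx (pinvmx R)) (mulmx R : 'M[F]_(n, m) -> 'M_m).
  by move=> A; rewrite mulmxA mulmxVp // mul1mx.
have := card_fiber 1%:M RK; rewrite !card_mx.
have -> : (n * m = m * (n - m) + m * m)%N by rewrite -mulnDr subnK // mulnC.
rewrite expnD => /eqP; rewrite eqn_pmul2r => [/eqP //|].
by rewrite expn_gt0 (ltnW (card_finNzRing_gt1 F)).
Qed.

(** The restriction R T of T to W is singular (G vanishes), invertible but not 1 (the weight
    vanishes), or 1; [card_linv] counts the last case. *)
Lemma sum_weight_id n (W : 'M[F]_n) (E : lmodType k) (G : 'M[F]_n -> E) x :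
  (forall T : 'M_n, (T <= W)%MS -> (\rank (W *m T) < \rank W)%N -> G T = 0) ->
  (forall T : 'M_n, (T <= W)%MS -> W *m T = W -> G T = x) ->
  \sum_(T : 'M_n | (T <= W)%MS) weight T *: G T =
    (#|F|%:R ^+ (\rank W * (n - \rank W)) * mu F (\rank W)) *: x.
Proof.
move=> G0 G1; rewrite sum_weight_sub; set R := row_base W.
have RW (T : 'M_(n, \rank W)) : (T *m R <= W)%MS by rewrite -(eq_row_base W) submxMl.
rewrite (eq_bigr (fun T => if R *m T == 1%:M then mu F (\rank W) *: x else 0)).
  rewrite -big_mkcond sumr_const (card_linv (row_base_free W)).
  by rewrite -scaler_nat scalerA natrX.
move=> T _; have WT : W *m (T *m R) = col_base W *m (R *m T) *m R.
  by rewrite -{1}(mulmx_base W) -!mulmxA.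
have [RT|RT] := eqVneq (R *m T) 1%:M.
  rewrite RT weight_unit ?unitmx1 // eqxx (G1 _ (RW T)) //.
  by rewrite WT RT mulmx1 mulmx_base.
have [RTu|RTu] := boolP (R *m T \in unitmx).
  by rewrite weight_unit // (negPf RT) scale0r.
rewrite (G0 _ (RW T)) ?scaler0 // WT.
apply: leq_ltn_trans (mxrankM_maxl _ _) _; apply: leq_ltn_trans (mxrankM_maxr _ _) _.
by rewrite ltn_neqAle rank_leq_row -row_free_unit in RTu *; rewrite RTu.
Qed.

(** * Products of the elements eta_W *)

Definition eta_coef n (W : 'M[F]_n) : k :=
  #|F|%:R ^- (\rank W * (n - \rank W)) * (mu F (\rank W))^-1.

Lemma eta_coefK n (W : 'M[F]_n) :
  eta_coef W * (#|F|%:R ^+ (\rank W * (n - \rank W)) * mu F (\rank W)) = 1.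
Proof. by rewrite /eta_coef -invfM mulVf // mulf_neq0 ?expf_neq0 ?mu_neq0. Qed.

Lemma etaE n (W T : 'M[F]_n) :
  eta k W T = if (T <= W)%MS then eta_coef W * weight T else 0.
Proof.
rewrite /eta ffunE sum_ffunE big_mkcond (bigD1 T) //= big1 => [|m mT].
  rewrite !ffunE eqxx addr0 /weight.
  case: (semi_idem T) (T <= W)%MS => [][] //=; rewrite ?mulr0 ?scaler0 //.
  by congr (_ * _); apply: mulr1.
by rewrite !ffunE eq_sym (negPf mT) scaler0 if_same.
Qed.

Lemma sum_eta n (W : 'M[F]_n) (E : lmodType k) (G : 'M[F]_n -> E) :
  \sum_m (eta k W m : k) *: G m =
  eta_coef W *: \sum_(T | (T <= W)%MS) weight T *: G T.
Proof.
rewrite scaler_sumr [RHS]big_mkcond; apply: eq_bigr => m _.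
by rewrite etaE; case: ifP => _; rewrite ?scale0r ?scalerA.
Qed.

Lemma eta_sum n (W : 'M[F]_n) :
  eta k W = eta_coef W *: \sum_(T | (T <= W)%MS) weight T *: mbase k T.
Proof.
rewrite -sum_eta; apply/ffunP=> T; rewrite sum_ffunE (bigD1 T) //= big1 => [|m mT].
  by rewrite !ffunE eqxx addr0; apply/esym; apply: mulr1.
by rewrite !ffunE eq_sym (negPf mT) scaler0.
Qed.

Lemma amul_sum n (f g : {ffun 'M[F]_n -> k^o}) :
  amul f g = \sum_a (f a : k) *: \sum_b (g b : k) *: mbase k (b *m a).
Proof.
apply/ffunP=> m; rewrite ffunE sum_ffunE; apply: eq_bigr => a _.
rewrite ffunE sum_ffunE scaler_sumr big_mkcond; apply: eq_bigr => b _.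
rewrite !ffunE eq_sym /mcomp; case: eqP => _; first by congr (_ * _); apply/esym/mulr1.
by rewrite !scaler0.
Qed.

Lemma amul_eta n (W1 W2 : 'M[F]_n) :
  amul (eta k W1) (eta k W2) =
  eta_coef W1 *: \sum_(T1 | (T1 <= W1)%MS) weight T1 *:
    (eta_coef W2 *: \sum_(T2 | (T2 <= W2)%MS) weight T2 *: mbase k (T2 *m T1)).
Proof.
rewrite amul_sum sum_eta; congr (_ *: _); apply: eq_bigr => T _.
by rewrite sum_eta.
Qed.

(** For a left factor T not injective on W, the inner sum vanishes; if T is the identity on W, then
    T2 T = T2 and the inner sum is eta_W again. *)
Lemma eta_idem n (W : 'M[F]_n) : amul (eta k W) (eta k W) = eta k W.
Proof.
rewrite amul_eta (sum_weight_id (x := eta k W)) => [|T TW WT|T TW WT].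
- by rewrite scalerA eta_coefK scale1r.
- by rewrite sum_weight_mulr_eq0 ?scaler0.
- rewrite eta_sum; congr (_ *: _); apply: eq_bigr => _ /submxP[D ->].
  by rewrite -mulmxA WT.
Qed.

(** If W1 is strictly inside W2, no T1 is injective on W2. Otherwise T2 T1 only sees T1 on im T2,
    which does not contain W1, so the sum over T1 is taken first. *)
Lemma eta_orth n (W1 W2 : 'M[F]_n) :
  ~~ (W1 == W2)%MS -> amul (eta k W1) (eta k W2) = 0.
Proof.
rewrite negb_and amul_eta => W12; have [W1W2|W1W2] := boolP (W1 <= W2)%MS.
  rewrite W1W2 /= in W12; rewrite big1 ?scaler0 // => T1 T1W1.
  rewrite sum_weight_mulr_eq0 ?scaler0 //.
  apply: leq_ltn_trans (mxrankM_maxr _ _) _.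
  apply: leq_ltn_trans (mxrankS T1W1) _.
  have : (W1 < W2)%MS by rewrite ltmxE W1W2.
  by rewrite ltmxErank => /andP[].
rewrite (eq_bigr (fun T1 => \sum_(T2 | (T2 <= W2)%MS)
    eta_coef W2 *: (weight T2 *: (weight T1 *: mbase k (T2 *m T1))))) => [|T1 _].
  rewrite exchange_big big1 ?scaler0 // => T2 T2W2.
  rewrite -!scaler_sumr (@sum_weight_mull_eq0 _ _ W1 T2) ?scaler0 //.
  by apply: contra W1W2 => /submx_trans ->.
rewrite !scaler_sumr; apply: eq_bigr => T2 _.
by rewrite !scalerA -mulrA mulrC.
Qed.

(** * Images in the groupoid algebra *)

Lemma psi_eta n r (W : 'M[F]_n) :
  psi r (eta k W) =
  eta_coef W *: \sum_(U : 'M_n | (<<U>>%MS == U) && (\rank U == r))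
    \sum_(T | (T <= W)%MS) weight T *:
      (if \rank (U *m T) == r then gbase k (U, U *m T) else 0).
Proof.
rewrite /psi sum_eta exchange_big; congr (_ *: _); apply: eq_bigr => T _ /=.
rewrite -scaler_sumr; congr (_ *: _); rewrite -big_mkcondr.
by apply: eq_bigl => U; rewrite andbA.
Qed.

Lemma psi_eta_lt n r (W : 'M[F]_n) : (\rank W < r)%N -> psi r (eta k W) = 0.
Proof.
move=> Wr; rewrite psi_eta big1 ?scaler0 // => U _; rewrite big1 // => T TW.
rewrite ltn_eqF ?scaler0 //; apply: leq_ltn_trans Wr.
exact: leq_trans (mxrankM_maxr _ _) (mxrankS TW).
Qed.

(** A subspace U of the same rank other than W does not contain W, so its terms cancel; on W itself
    only the T restricting to the identity survive. *)
Lemma psi_eta_rank n (W : 'M[F]_n) :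
  psi (\rank W) (eta k W) = gbase k (gres <<W>>%MS 1%:M).
Proof.
rewrite psi_eta (bigD1 <<W>>%MS) /=; last by rewrite genmx_id eqxx mxrank_gen eqxx.
rewrite (sum_weight_id (x := gbase k (gres <<W>>%MS 1%:M))) => [|T TW|T TW WT].
- rewrite big1 ?addr0 ?scalerA ?eta_coefK ?scale1r // => U /andP[/andP[/eqP U1 /eqP U2] UW].
  apply: (@sum_weight_mull_eq0 _ _ W U _
    (fun A => if \rank A == \rank W then gbase k (U, A) else 0)).
  apply: contra UW => WU; rewrite -U1 eq_sym; apply/eqP/eq_genmx/eqmxP.
  by rewrite -(mxrank_leqif_eq WU) U2.
- by rewrite (eqmxMr T (genmxE W)) => WT; rewrite ltn_eqF.
- have -> : <<W>>%MS *m T = <<W>>%MS.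
    have /submxP[D ->] : (<<W>> <= W)%MS by rewrite genmxE.
    by rewrite -mulmxA WT.
  by rewrite mxrank_gen eqxx /gres mulmx1.
Qed.

(** * Comparison of coefficients for eta_r *)

Lemma mu_sqr i : mu F i * mu F i = #|F|%:R ^+ (i * i.-1) :> k.
Proof.
elim: i => [|i IH]; first by rewrite /mu bin0n !expr0 !mulr1.
rewrite muS mulrACA mulrNN IH -!exprD; congr (_ ^+ _).
by case: i {IH} => //= i; nia.
Qed.

Lemma eta_coefE n (W : 'M[F]_n) :
  eta_coef W = #|F|%:R ^- ((n - 1) * \rank W) * mu F (\rank W).
Proof.
rewrite /eta_coef; move: (rank_leq_row W); move: (\rank W) => w wn.
have Q0 i : (#|F|%:R ^+ i : k) != 0 by rewrite expf_neq0.
apply: (mulIf (mu_neq0 w)); rewrite mulfVK ?mu_neq0 // -mulrA mu_sqr.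
apply: (mulfI (Q0 ((n - 1) * w)%N)); rewrite mulVKf //.
have -> : ((n - 1) * w = w * w.-1 + w * (n - w))%N.
  by rewrite -mulnDr mulnC; case: w wn => // w wn; congr (_ * _)%N; lia.
by rewrite exprD mulfK.
Qed.

Lemma sum_eta_coef_rank n (A : 'M[F]_n) w : (\rank A <= w)%N ->
  \sum_(W : 'M_n | (<<W>>%MS == W) && (A <= W)%MS && (\rank W == w)) eta_coef W =
  #|F|%:R ^- ((n - 1) * w) * mu F w * (qbin F (n - \rank A) (w - \rank A))%:R.
Proof.
move=> Aw; rewrite -card_overspaces // mulr_natr -sumr_const.
apply: eq_big => W; first by rewrite !inE andbA.
by case/andP=> _ /eqP <-; rewrite eta_coefE.
Qed.

(** Induction on r: [qbinS_dual] splits the contribution of rank r + 1 into a term cancelling the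
    sum up to r and the claimed value. *)
Lemma sum_eta_coef n (A : 'M[F]_n) r : (r < n)%N ->
  \sum_(W : 'M_n | (<<W>>%MS == W) && (A <= W)%MS && (\rank W <= r)%N) eta_coef W =
  if (\rank A <= r)%N then
    #|F|%:R ^- ((n - 1) * r) * mu F r * (qbin F (n - 1 - \rank A) (r - \rank A))%:R
  else 0.
Proof.
have sum0 s : (s < \rank A)%N ->
    \sum_(W : 'M_n | (<<W>>%MS == W) && (A <= W)%MS && (\rank W <= s)%N) eta_coef W = 0.
  move=> sA; rewrite big1 // => W /andP[/andP[_ /mxrankS AW] Ws].
  by have := leq_ltn_trans (leq_trans AW Ws) sA; rewrite ltnn.
elim: r => [|r IH] rn.
  case: leqP => [A0|/sum0 //].
  rewrite (eq_bigl _ _ (fun W => congr1 (andb _) (leqn0 (\rank W)))).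
  by rewrite sum_eta_coef_rank // (eqP (_ : \rank A == 0%N)) -?leqn0 // !subn0 !qbin0.
case: leqP => [Ar|/sum0 //].
rewrite (bigID (fun W : 'M_n => (\rank W <= r)%N)) /=.
rewrite (eq_bigl (fun W : 'M_n => (<<W>>%MS == W) && (A <= W)%MS && (\rank W <= r)%N)); last first.
  by move=> W; rewrite -!andbA; do 2!congr (_ && _); case: (leqP _ r) => [/leqW ->|]; rewrite ?andbF.
rewrite [X in _ + X](eq_bigl (fun W : 'M_n =>
    (<<W>>%MS == W) && (A <= W)%MS && (\rank W == r.+1))); last first.
  by move=> W; rewrite -!andbA -ltnNge -eqn_leq.
rewrite IH ?(ltnW rn) // sum_eta_coef_rank //; move: Ar; rewrite leq_eqVlt ltnS.
(* If rank A = r + 1, no W of rank at most r contains A and both binomials are 1. *)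
case: eqP => [-> _|_ /= Ar].
  by rewrite ltnn add0r subnn !qbin0.
rewrite Ar !subSn //.
have -> : (n - \rank A = (n - 1 - \rank A).+1)%N by lia.
rewrite qbinS_dual natrD mulrDr addrA -[RHS]add0r; congr (_ + _).
rewrite natrM natrX mulrA -mulrDl.
have -> : (n - 1 - \rank A - (r - \rank A) = n - 1 - r)%N by lia.
have -> : ((n - 1) * r.+1 = (n - 1) * r + r + (n - 1 - r))%N by nia.
rewrite muS !exprD.
have : (#|F|%:R ^+ (n - 1 - r) : k) != 0 by rewrite expf_neq0.
have : (#|F|%:R ^+ r : k) != 0 by rewrite expf_neq0.
have : (#|F|%:R ^+ ((n - 1) * r) : k) != 0 by rewrite expf_neq0.
move: (_ ^+ _) (_ ^+ _) (_ ^+ _) => x y z x0 y0 z0.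
by field; rewrite x0 y0 z0.
Qed.

Lemma eta_rE n r (T : 'M[F]_n) :
  eta_r F k n r T = if (\rank T <= r)%N then
    #|F|%:R ^- ((n - 1) * r) * mu F r * (qbin F (n - 1 - \rank T) (r - \rank T))%:R
      * weight T else 0.
Proof.
rewrite /eta_r ffunE sum_ffunE big_mkcond (bigD1 T) //= big1 => [|m mT].
  rewrite !ffunE eqxx addr0 /weight.
  case: (semi_idem T) (\rank T <= r)%N => [][] //=; rewrite ?mulr0 ?scaler0 //.
  by rewrite -mulrA [_%:R * mu _ _]mulrC; congr (_ * _); apply: mulr1.
by rewrite !ffunE eq_sym (negPf mT) scaler0 if_same.
Qed.

Lemma eta_r_sum n r : (r < n)%N ->
  eta_r F k n r = \sum_(W : 'M[F]_n | (<<W>>%MS == W) && (\rank W <= r)%N) eta k W.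
Proof.
move=> rn; apply/ffunP=> T; rewrite eta_rE sum_ffunE.
transitivity ((\sum_(W : 'M_n | (<<W>>%MS == W) && (T <= W)%MS && (\rank W <= r)%N)
    eta_coef W) * weight T).
  by rewrite sum_eta_coef //; case: ifP; rewrite ?mul0r.
rewrite big_distrl /= [RHS](bigID (fun W => T <= W)%MS) /= [X in _ + X]big1 ?addr0.
  by apply: eq_big => W; rewrite ?etaE; [rewrite andbAC|case/andP=> /andP[_ ->]].
by move=> W /andP[_ TW]; rewrite etaE (negPf TW).
Qed.

End Weight.

Theorem theorem4p2 (F : finFieldType) (k : fieldType) (n : nat)
    (hq : (#|F|%:R : k) != 0) :
  [/\ (forall W : 'M[F]_n, amul (eta k W) (eta k W) = eta k W),
      (forall W1 W2 : 'M[F]_n, ~~ (W1 == W2)%MS ->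
          amul (eta k W1) (eta k W2) = 0),
      (forall r : nat, (r < n)%N ->
          eta_r F k n r =
          \sum_(W : 'M[F]_n | (<<W>>%MS == W) && (\rank W <= r)%N) eta k W),
      (forall (r : nat) (W : 'M[F]_n), \rank W = r ->
          psi r (eta k W) = gbase k (gres <<W>>%MS 1%:M)) &
      (forall (r : nat) (W : 'M[F]_n), (\rank W < r)%N ->
          psi r (eta k W) = 0)].
Proof.
split.
- exact: eta_idem.
- exact: eta_orth.
- exact: eta_r_sum.
- by move=> r W <-; apply: psi_eta_rank.
- exact: psi_eta_lt.
Qed.
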